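(* Let $\epsilon\in[0,\sqrt2]$. Then $S_\epsilon$ is monotonicity preserving and strictly monotonicity preserving. That is, for every $f\in\ell_\infty(\mathbb{Z})$, writing $\nabla f_i=f_{i+1}-f_i$: if $\nabla f_i\ge0$ for all $i\in\mathbb{Z}$ (respectively $\le0$, $>0$, $<0$ for all $i\in\mathbb{Z}$), then $\nabla(S_\epsilon f)_i\ge0$ for all $i\in\mathbb{Z}$ (respectively $\le0$, $>0$, $<0$ for all $i\in\mathbb{Z}$).
   Context: $\ell_\infty(\mathbb{Z})$ is the space of bounded real sequences indexed by $\mathbb{Z}$. For a parameter $\epsilon$, define $\Gamma_\epsilon:\mathbb{R}^4\to\mathbb{R}$ by $$\Gamma_\epsilon(f_{-1},f_0,f_1,f_2)=\begin{cases}\dfrac12\,\dfrac{1}{\left(1+\sqrt{1+\frac{f_2-f_{-1}}{f_1-f_0}}\right)^2-1}, & f_1\ne f_0 \text{ and } 1+\frac{f_2-f_{-1}}{f_1-f_0}\ge \epsilon^2,\\[4pt] 0, & f_{-1}\le f_0=f_1\le f_2 \text{ or } f_{-1}\ge f_0=f_1\ge f_2,\\[2pt] \frac1{16}, & \text{otherwise.}\end{cases}$$ (For $\epsilon=0$ the first case is used only where its denominator is nonzero.) The scheme $S_\epsilon$ is given by $$(S_\epsilon f)_{2i}=f_i,\qquad (S_\epsilon f)_{2i+1}=\tfrac12 f_i+\tfrac12 f_{i+1}-\Gamma_\epsilon(f_{i-1},f_i,f_{i+1},f_{i+2})\,(f_{i+2}-f_{i+1}-f_i+f_{i-1}).$$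 *)

(* Defs.v *)
From HB Require Import structures.
From mathcomp Require Import all_boot all_order all_algebra.
From mathcomp Require Import all_classical all_reals all_analysis.

Set Implicit Arguments.
Unset Strict Implicit.
Unset Printing Implicit Defensive.

Import Order.TTheory GRing.Theory Num.Theory.
Import numFieldNormedType.Exports.

Local Open Scope classical_set_scope.
Local Open Scope ring_scope.

Definition linfty (R : realType) : set (int -> R) :=
  [set f | bounded_fun f].

Definition nabla (R : realType) (f : int -> R) (i : int) : R := f (i + 1) - f i.

(* The arguments fm1, f0, f1, f2 are f_{-1}, f_0, f_1, f_2. *)
Definition diff_ratio (R : realType) (fm1 f0 f1 f2 : R) : R :=
  1 + (f2 - fm1) / (f1 - f0).

(* The test [den != 0] matters only for [eps = 0]: if [0 < eps] then
   [eps ^+ 2 <= r] forces [0 < den].  For [eps = 0], [f1 != f0] and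
   [r = 0], the value is 1/16. *)
Definition Gamma (R : realType) (eps fm1 f0 f1 f2 : R) : R :=
  let r := diff_ratio fm1 f0 f1 f2 in
  let den := (1 + Num.sqrt r) ^+ 2 - 1 in
  if [&& f1 != f0, eps ^+ 2 <= r & den != 0] then 1 / 2 * (1 / den)
  else if [&& fm1 <= f0, f0 == f1 & f1 <= f2]
       || [&& fm1 >= f0, f0 == f1 & f1 >= f2] then 0
  else 1 / 16.

(* Division in [int] by 2 rounds down, so [k %/ 2] is the [i] with [k = 2i] or
   [k = 2i+1], also for negative [k]; see [schemeE_even] and [schemeE_odd].
   The scheme is defined on all bi-infinite sequences: for [eps = 0] it need
   not map bounded sequences to bounded ones. *)
Definition scheme (R : realType) (eps : R) (f : int -> R) (k : int) : R :=
  let i := (k %/ 2)%Z in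
  if (2 %| k)%Z then f i
  else 1 / 2 * f i + 1 / 2 * f (i + 1)
       - Gamma eps (f (i - 1)) (f i) (f (i + 1)) (f (i + 2))
         * (f (i + 2) - f (i + 1) - f i + f (i - 1)).

Lemma schemeE_even (R : realType) (eps : R) (f : int -> R) (i : int) :
  scheme eps f (2 * i) = f i.
Proof. by rewrite /scheme dvdz_mulr ?dvdzz // mulKz. Qed.

Lemma schemeE_odd (R : realType) (eps : R) (f : int -> R) (i : int) :
  scheme eps f (2 * i + 1) =
    1 / 2 * f i + 1 / 2 * f (i + 1)
    - Gamma eps (f (i - 1)) (f i) (f (i + 1)) (f (i + 2))
      * (f (i + 2) - f (i + 1) - f i + f (i - 1)).
Proof.
by rewrite /scheme rpredDl ?dvdz_mulr //= [2 * i]mulrC divzMDl // addr0.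
Qed.

Definition monotonicity_preserving (R : realType)
    (S : (int -> R) -> int -> R) : Prop :=
  forall f : int -> R, linfty f ->
    ((forall i, 0 <= nabla f i) -> forall i, 0 <= nabla (S f) i) /\
    ((forall i, nabla f i <= 0) -> forall i, nabla (S f) i <= 0).

Definition strictly_monotonicity_preserving (R : realType)
    (S : (int -> R) -> int -> R) : Prop :=
  forall f : int -> R, linfty f ->
    ((forall i, 0 < nabla f i) -> forall i, 0 < nabla (S f) i) /\
    ((forall i, nabla f i < 0) -> forall i, nabla (S f) i < 0).

(* Main.v *)
(** Write [a, b, c] for the consecutive differences of [fm1, f0, f1, f2] and
    [s] for the square root of the ratio, so that [s ^+ 2 = 2 + (a + c) / b].
    The new differences are [b / 2 - G] and [b / 2 + G] with
    [G = Gamma * (c - a)].  For nonnegative data with [b > 0] the ratio is at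
    least [2 >= eps ^+ 2], so the first case of [Gamma] applies, and
    [`|c - a| / b <= s ^+ 2 - 2 < s ^+ 2 + 2 * s] yields [`|G| < b / 2].
    The decreasing case follows because the scheme is odd. *)
Require Import Defs.
From mathcomp Require Import all_boot all_order all_algebra.
From mathcomp Require Import all_classical all_reals all_analysis.
From mathcomp Require Import ring lra.

Import Order.TTheory GRing.Theory Num.Theory.

Local Open Scope ring_scope.

(** Both differences in the ratio change sign, and the increasing and decreasing tests for the value
    0 trade places. *)
Lemma GammaN (R : realType) (eps a b c d : R) :
  Gamma eps (- a) (- b) (- c) (- d) = Gamma eps a b c d.
Proof.
have ratioN : diff_ratio (- a) (- b) (- c) (- d) = diff_ratio a b c d.
  by rewrite /diff_ratio -!opprD invrN mulrNN.
by rewrite /Gamma ratioN !eqr_opp !lerN2 [X in if X then 0 else _]orbC.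
Qed.

Lemma schemeN (R : realType) (eps : R) (f : int -> R) (k : int) :
  scheme eps (fun i => - f i) k = - scheme eps f k.
Proof. by rewrite /scheme GammaN; case: ifP => // _; ring. Qed.

Lemma nablaN (R : realType) (f : int -> R) (k : int) :
  nabla (fun i => - f i) k = - nabla f k.
Proof. by rewrite /nabla opprD. Qed.

Lemma nabla_schemeN (R : realType) (eps : R) (f : int -> R) (k : int) :
  nabla (scheme eps (fun i => - f i)) k = - nabla (scheme eps f) k.
Proof. by rewrite /nabla !schemeN opprD. Qed.

Lemma Gamma_flat (R : realType) (eps fm1 f0 f2 : R) :
  fm1 <= f0 -> f0 <= f2 -> Gamma eps fm1 f0 f0 f2 = 0.
Proof. by move=> h0 h2; rewrite /Gamma eqxx /= h0 h2. Qed.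

Lemma Gamma_correction_lt (R : realType) (eps fm1 f0 f1 f2 : R) :
  eps ^+ 2 <= 2 -> fm1 <= f0 -> f0 < f1 -> f1 <= f2 ->
  `|Gamma eps fm1 f0 f1 f2 * (f2 - f1 - f0 + fm1)| < (f1 - f0) / 2.
Proof.
move=> he h0 h1 h2; rewrite /Gamma.
set r := diff_ratio _ _ _ _.
have b_gt0 : 0 < f1 - f0 by rewrite subr_gt0.
have rb : r * (f1 - f0) = (f1 - f0) + (f2 - fm1).
  by rewrite /r /diff_ratio; field; rewrite gt_eqF.
(* The outer increment [f2 - fm1] contains the inner one [f1 - f0], so their quotient is at least
   1. *)
have r_ge2 : 2 <= r by rewrite -(ler_pM2r b_gt0) rb; lra.
have s_gt0 : 0 < Num.sqrt r by rewrite sqrtr_gt0; lra.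
have sE : Num.sqrt r ^+ 2 = r by rewrite sqr_sqrtr //; lra.
have -> : (1 + Num.sqrt r) ^+ 2 - 1 = r + 2 * Num.sqrt r by rewrite -{2}sE; ring.
have den_gt0 : 0 < r + 2 * Num.sqrt r by lra.
rewrite (gt_eqF h1) (le_trans he r_ge2) (gt_eqF den_gt0) /=.
rewrite normrM gtr0_norm; last by rewrite mulr_gt0 ?divr_gt0.
have -> : 1 / 2 * (1 / (r + 2 * Num.sqrt r)) * `|f2 - f1 - f0 + fm1|
        = `|f2 - f1 - f0 + fm1| / (r + 2 * Num.sqrt r) / 2.
  by field; rewrite gt_eqF.
rewrite ltr_pM2r ?invr_gt0 // ltr_pdivrMr //.
(* With [rb] for the product of [r] and [f1 - f0], positivity of [(f1 - f0) * Num.sqrt r] is the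
   only other nonlinear fact; both bounds are then linear. *)
have := mulr_gt0 b_gt0 s_gt0; rewrite ltr_norml => bs.
by apply/andP; split; lra.
Qed.

(** Strictness is local: given monotone data, it depends only on the coarse difference that position
    [k] subdivides. *)
Lemma nabla_scheme_ge (R : realType) (eps : R) (f : int -> R) (k : int) :
  eps ^+ 2 <= 2 -> (forall i, 0 <= nabla f i) ->
  0 <= nabla (scheme eps f) k
    /\ (0 < nabla f (k %/ 2)%Z -> 0 < nabla (scheme eps f) k).
Proof.
move=> he mono; set i := (k %/ 2)%Z.
have h0 : f (i - 1) <= f i by have := mono (i - 1); rewrite /nabla subrK subr_ge0.
have h1 : f i <= f (i + 1) by have := mono i; rewrite /nabla subr_ge0.
have h2 : f (i + 1) <= f (i + 2).
  by have := mono (i + 1); rewrite /nabla -addrA subr_ge0.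
pose G := Gamma eps (f (i - 1)) (f i) (f (i + 1)) (f (i + 2))
          * (f (i + 2) - f (i + 1) - f i + f (i - 1)).
have nablaS : nabla (scheme eps f) k = (f (i + 1) - f i) / 2 - G
           \/ nabla (scheme eps f) k = (f (i + 1) - f i) / 2 + G.
  have kE : k = 2 * i + (k %% 2)%Z by rewrite mulrC -divz_eq.
  have : (k %% 2)%Z = 0 \/ (k %% 2)%Z = 1.
    have := ltz_pmod k (isT : 0 < 2 :> int); have := @modz_ge0 k 2 isT.
    by case: (k %% 2)%Z => [[|[|n]]|n] // _ _; [left|right].
  case=> m; rewrite m in kE; rewrite /nabla kE.
    by left; rewrite addr0 schemeE_even schemeE_odd -/G; field.
  (* For odd [k] the right endpoint is the next coarse point, where the scheme copies [f]. *)
  right; have -> : 2 * i + 1 + 1 = 2 * (i + 1) by ring.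
  by rewrite schemeE_even schemeE_odd -/G; field.
have [fi|h1'] := eqVneq (f i) (f (i + 1)); last first.
  have lt1 : f i < f (i + 1) by rewrite lt_neqAle h1' h1.
  have := Gamma_correction_lt _ _ _ _ _ _ he h0 lt1 h2.
  rewrite -/G ltr_norml => /andP[G1 G2].
  have nS : 0 < nabla (scheme eps f) k by case: nablaS => ->; lra.
  by split=> [|_] //; exact: ltW.
(* On a flat coarse interval the new differences are [- G] and [G], so [G] has to vanish; the zero
   case of [Gamma] ensures it. *)
have G0 : G = 0 by rewrite /G -fi Gamma_flat ?mul0r // fi.
split; last by rewrite /nabla fi subrr ltxx.
by case: nablaS => ->; rewrite G0 fi subrr mul0r ?subr0 ?addr0.
Qed.

Theorem theorem15 (R : realType) (eps : R)
    (heps0 : 0 <= eps) (heps2 : eps <= Num.sqrt 2) :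
  monotonicity_preserving (scheme eps) /\
  strictly_monotonicity_preserving (scheme eps).
Proof.
have he : eps ^+ 2 <= 2.
  by rewrite -[leRHS]sqr_sqrtr // ler_sqr ?nnegrE ?sqrtr_ge0.
have geS f k := nabla_scheme_ge _ _ f k he.
split=> f _; split=> mono k.
- by have [] := geS f k mono.
- rewrite -oppr_ge0 -nabla_schemeN.
  by apply: (geS _ _ _).1 => i; rewrite nablaN oppr_ge0.
- by apply: (geS _ _ _).2 => // i; exact: ltW.
- rewrite -oppr_gt0 -nabla_schemeN.
  apply: (geS _ _ _).2 => [i|]; last by rewrite nablaN oppr_gt0.
  by rewrite nablaN oppr_ge0 ltW.
Qed.
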